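(* Let $(X,X_+,\mathcal{K},f)$ be an ordered Banach space with a base, and let $T,S:X\to X$ be Markov operators. Then the following assertions hold: (i) $0\le \delta(T)\le 1$; (ii) $|\delta(T)-\delta(S)|\le \delta(T-S)\le \|T-S\|$; (iii) $\delta(TS)\le \delta(T)\,\delta(S)$; (iv) if $H:X\to X$ is a bounded linear operator such that $H^*(f)=0$ (that is, $f(Hx)=0$ for all $x\in X$), then $\|TH\|\le \delta(T)\|H\|$; (v) $\displaystyle \delta(T)=\frac12\sup_{u,v\in\mathcal{K}}\|Tu-Tv\|$; (vi) if $\delta(T)=0$, then there is $y_0\in X_+$ such that $T=T_{y_0}$.
   Context: Ordered Banach space with a base (OBSB) $(X,X_+,\mathcal{K},f)$: $X\neq\{0\}$ is a real ordered vector space with cone $X_+=\{x\in X: x\ge 0\}$ which is generating ($X=X_+-X_+$); $f$ is a linear functional on $X$ that is strictly positive ($f(x)>0$ whenever $x\in X_+$, $x\ne0$); $\mathcal{K}=\{x\in X_+: f(x)=1\}$ is the base. Let $U$ be the convex hull of $\mathcal{K}\cup(-\mathcal{K})$ and $\|x\|=\inf\{\lambda\ge 0: x\in\lambda U\}$. It is assumed that $U$ is linearly bounded (its intersection with every line is bounded), so that $\|\cdot\|$ is a norm, that $X$ is complete for this norm, and that $X_+$ is closed. All norms on $X$ are this norm, and norms of operators are the corresponding operator norms. One has $f(x)=\|x\|$ for $x\in X_+$. A linear operator $T:X\to X$ is positive if $Tx\ge0$ whenever $x\ge 0$; a positive linear operator $T$ is Markov if $T(\mathcal{K})\subset\mathcal{K}$.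 For $y\in X$, $T_y:X\to X$ is the operator $T_y(x)=f(x)y$. Let $N=\{x\in X: f(x)=0\}$. For a bounded linear operator $T:X\to X$, the Dobrushin ergodicity coefficient is $\delta(T)=\sup_{x\in N,\,x\ne0}\frac{\|Tx\|}{\|x\|}$ (with the supremum understood as $0$ if $N=\{0\}$). *)

(* Defs.v *)
From HB Require Import structures.
From mathcomp Require Import all_boot all_order all_algebra.
From mathcomp Require Import all_classical all_reals all_analysis.

Set Implicit Arguments.
Unset Strict Implicit.
Unset Printing Implicit Defensive.

Import Order.TTheory GRing.Theory Num.Theory.
Import numFieldNormedType.Exports.

Local Open Scope classical_set_scope.
Local Open Scope ring_scope.

Definition convex_hull (R : realType) (X : lmodType R) (A : set X) : set X :=
  smallest (@convex_set R X) A.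

Definition base (R : realType) (X : lmodType R) (Xp : set X) (f : {scalar X}) :
  set X := [set x | Xp x /\ f x = 1].

Definition base_ball (R : realType) (X : lmodType R) (Xp : set X)
    (f : {scalar X}) : set X :=
  convex_hull (base Xp f `|` [set - x | x in base Xp f]).

Definition gauge (R : realType) (X : lmodType R) (U : set X) (x : X) : R :=
  inf [set lambda : R | 0 <= lambda /\ [set lambda *: u | u in U] x].

(* Each line is given by a point [a] and a nonzero direction [d]; boundedness
   of its trace on [U] is boundedness of the set of parameters. *)
Definition linearly_bounded (R : realType) (X : lmodType R) (U : set X) : Prop :=
  forall a d : X, d != 0 -> bounded_set [set t : R | U (a + t *: d)].

(* The vector order is given by its positive cone [Xp]: x <= y iff Xp (y - x). *)
Record ordered_cone (R : realType) (X : lmodType R) (Xp : set X) : Prop :=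
  OrderedCone {
    cone0 : Xp 0;
    coneD : forall x y : X, Xp x -> Xp y -> Xp (x + y);
    coneZ : forall (a : R) (x : X), 0 <= a -> Xp x -> Xp (a *: x);
    cone_pointed : forall x : X, Xp x -> Xp (- x) -> x = 0 }.

(* Completeness is carried by the type of [X]; [obsb_norm] states that the norm
   of [X] (hence its topology) is the base norm. *)
Record obsb (R : realType) (X : completeNormedModType R) (Xp : set X)
    (f : {scalar X}) : Prop := OBSB {
  obsb_nontrivial : exists x : X, x != 0;
  obsb_cone : ordered_cone Xp;
  obsb_generating : forall x : X, exists y z : X, [/\ Xp y, Xp z & x = y - z];
  obsb_strictly_positive : forall x : X, Xp x -> x != 0 -> 0 < f x;
  obsb_linearly_bounded : linearly_bounded (base_ball Xp f);
  obsb_norm : forall x : X, `|x| = gauge (base_ball Xp f) x;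
  obsb_closed : closed Xp }.

Definition positive_operator (R : realType) (X : lmodType R) (Xp : set X)
    (T : {linear X -> X}) : Prop := forall x : X, Xp x -> Xp (T x).

Definition markov_operator (R : realType) (X : lmodType R) (Xp : set X)
    (f : {scalar X}) (T : {linear X -> X}) : Prop :=
  positive_operator Xp T /\ [set T x | x in base Xp f] `<=` base Xp f.

(* The two suprema below are meant for bounded operators: [sup] of an unbounded
   set is 0. The convention [sup set0 = 0] gives 0 when the kernel of [f] is
   trivial. *)
Definition opnorm (R : realType) (X : normedModType R) (T : {linear X -> X}) : R :=
  sup [set `|T x| / `|x| | x in [set x : X | x != 0]].

Definition dobrushin (R : realType) (X : normedModType R) (f : {scalar X})
    (T : {linear X -> X}) : R :=
  sup [set `|T x| / `|x| | x in [set x : X | f x = 0 /\ x != 0]].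

Definition rank_one (R : realType) (X : lmodType R) (f : {scalar X}) (y x : X) :
  X := f x *: y.

(* Main.v *)
Require Import Defs.
From HB Require Import structures.
From mathcomp Require Import all_boot all_order all_algebra.
From mathcomp Require Import all_classical all_reals all_analysis.
From mathcomp Require Import lra.

Set Implicit Arguments.
Unset Strict Implicit.
Unset Printing Implicit Defensive.

Import Order.TTheory GRing.Theory Num.Theory.
Import numFieldNormedType.Exports.

Local Open Scope classical_set_scope.
Local Open Scope ring_scope.

(** Everything rests on one description of the base norm: [`|x|] is the
infimum of the values [f p + f q] over the decompositions
[x = p - q] with [p] and [q] in the cone ([base_norm_decomp], [norm_cone_le]).
A Markov operator preserves the cone and preserves [f], so it sends such a
decomposition of [x] to one of [T x] with the same value; hence it is a
contraction ([markov_contraction]), and it maps the kernel of [f] into itself.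

When [f x = 0], the two pieces have the same value [r], so after normalising
them [x = r *: (u - v)] with [u] and [v] in the base and [2 * r] as close to
[`|x|] as desired ([kernel_decomp]). Thus the unit ball of the kernel is,
approximately, made of the halved differences of points of the base, which is
why the Dobrushin coefficient is half the diameter of the image of the base
([dobrushin_base]).

The remaining assertions are those of an operator norm: the coefficient is the
norm of the restriction to the kernel of [f], so it is subadditive, and it is
submultiplicative when the inner operator maps that kernel, or the whole space,
into the kernel. If it vanishes, [T] factors through [f], because
[x - f x *: w] is in the kernel for any [w] in the base. *)

(** * Suprema of norm ratios *)

Section ratio_sup.
Context (R : realType) (X : normedModType R).

(** The common form of the operator norm and of the Dobrushin coefficient, both
of which are instances of it by conversion. *)
Definition ratio_sup (D : set X) (A : X -> X) : R :=
  sup [set `|A x| / `|x| | x in D].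

(** Holds for an unbounded operator too, since the supremum of an unbounded set
is [0]. *)
Lemma ratio_sup_ge0 D A : 0 <= ratio_sup D A.
Proof.
rewrite /ratio_sup; set E := [set _ | _ in _].
have [[[y Ey] Eb]|] := pselect (has_sup E); last by move/sup_out ->.
apply: le_trans _ (ub_le_sup Eb Ey); case: Ey => x _ <-.
by rewrite divr_ge0.
Qed.

Lemma ratio_sup_le D A c : 0 <= c ->
  (forall x, D x -> `|A x| <= c * `|x|) -> ratio_sup D A <= c.
Proof.
move=> c0 Ac; have [->|/set0P D0] := eqVneq D set0.
  by rewrite /ratio_sup image_set0 sup0.
apply: ge_sup => [|_ [x Dx <-]]; first exact: image_nonempty.
have [x0|x0] := eqVneq `|x| 0; first by rewrite x0 invr0 mulr0.
by rewrite ler_pdivrMr ?lt_neqAle 1?eq_sym ?x0 ?normr_ge0// Ac.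
Qed.

(** The constant [c] makes the set of ratios bounded, so that its supremum is an
upper bound and not the default value [0]. *)
Lemma le_ratio_sup D A c x : D x -> 0 <= c ->
  (forall x, D x -> `|A x| <= c * `|x|) ->
  `|A x| <= ratio_sup D A * `|x|.
Proof.
move=> Dx c0 Ac.
have [x0|x0] := eqVneq `|x| 0.
  by rewrite x0 mulr0 -(mulr0 c) -x0 Ac.
rewrite -ler_pdivrMr ?lt_neqAle 1?eq_sym ?x0 ?normr_ge0//.
apply: ub_le_sup; last by exists x.
exists c => _ [y Dy <-].
have [y0|y0] := eqVneq `|y| 0; first by rewrite y0 invr0 mulr0.
by rewrite ler_pdivrMr ?lt_neqAle 1?eq_sym ?y0 ?normr_ge0// Ac.
Qed.

End ratio_sup.

(** * Operator norm and Dobrushin coefficient *)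

Section operators.
Context (R : realType) (X : normedModType R).
Implicit Types (f : {scalar X}) (A : {linear X -> X}).

Lemma le_opnorm A c x : 0 <= c -> (forall x, `|A x| <= c * `|x|) ->
  `|A x| <= opnorm A * `|x|.
Proof.
move=> c0 Ac; have [->|x0] := eqVneq x 0.
  by rewrite linear0 normr0 mulr0.
by apply: (@le_ratio_sup _ _ [set x | x != 0] A c) => // y _.
Qed.

Lemma le_dobrushin f A c x : 0 <= c -> (forall x, `|A x| <= c * `|x|) ->
  f x = 0 -> `|A x| <= dobrushin f A * `|x|.
Proof.
move=> c0 Ac fx; have [->|x0] := eqVneq x 0.
  by rewrite linear0 normr0 mulr0.
by apply: (@le_ratio_sup _ _ [set x | f x = 0 /\ x != 0] A c) => // y _.
Qed.

Lemma dobrushin_le f A c : 0 <= c ->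
  (forall x, f x = 0 -> `|A x| <= c * `|x|) -> dobrushin f A <= c.
Proof. by move=> c0 Ac; apply: ratio_sup_le => // x [fx _]; exact: Ac. Qed.

Lemma opnorm_le A c : 0 <= c ->
  (forall x, `|A x| <= c * `|x|) -> opnorm A <= c.
Proof. by move=> c0 Ac; apply: ratio_sup_le => // x _; exact: Ac. Qed.

Lemma dobrushin_ge0 f A : 0 <= dobrushin f A.
Proof. exact: ratio_sup_ge0. Qed.

Lemma opnorm_ge0 A : 0 <= opnorm A.
Proof. exact: ratio_sup_ge0. Qed.

Lemma dobrushin_le_opnorm f A c : 0 <= c ->
  (forall x, `|A x| <= c * `|x|) -> dobrushin f A <= opnorm A.
Proof.
move=> c0 Ac; apply: dobrushin_le => [|x _]; first exact: opnorm_ge0.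
exact: le_opnorm Ac.
Qed.

(** Subadditivity of the coefficient, applied to [A = (A - B) + B]. *)
Lemma dobrushin_leD f (A B : {linear X -> X}) a b : 0 <= a -> 0 <= b ->
  (forall x, `|A x| <= a * `|x|) -> (forall x, `|B x| <= b * `|x|) ->
  dobrushin f A <= dobrushin f (A \- B) + dobrushin f B.
Proof.
move=> a0 b0 Aa Bb.
apply: dobrushin_le => [|x fx]; first by rewrite addr_ge0 ?dobrushin_ge0.
rewrite mulrDl -[A x](subrK (B x)); apply: le_trans (ler_normD _ _) _.
apply: lerD; last exact: le_dobrushin Bb fx.
apply: (@le_dobrushin f (A \- B) (a + b)) => // [|y]; first exact: addr_ge0.
by rewrite mulrDl; apply: le_trans (ler_normB _ _) _; exact: lerD.
Qed.

Lemma dobrushin_subC f (A B : {linear X -> X}) :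
  dobrushin f (A \- B) = dobrushin f (B \- A).
Proof.
rewrite /dobrushin; congr sup; apply: eq_imagel => x _ /=.
by rewrite distrC.
Qed.

End operators.

(** * The base norm *)

Section base_norm.
Context (R : realType) (X : completeNormedModType R) (Xp : set X).
Context (f : {scalar X}) (HX : obsb Xp f).
Let cX := obsb_cone HX.

Lemma functional_ge0 x : Xp x -> 0 <= f x.
Proof.
move=> Xx; have [->|x0] := eqVneq x 0; first by rewrite linear0.
exact/ltW/(obsb_strictly_positive HX).
Qed.

(** The right-hand side defines a convex set which contains the base and its
opposite, hence their convex hull. *)
Lemma base_ball_decomp u : base_ball Xp f u ->
  exists p q, [/\ Xp p, Xp q, u = p - q & f p + f q <= 1].
Proof.
pose V := [set u | exists p q, [/\ Xp p, Xp q, u = p - q & f p + f q <= 1]].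
suff sub : base_ball Xp f `<=` V by move=> /sub.
apply: smallest_sub => [|x [[Xx fx]|[v [Xv fv] <-]]]; last 2 first.
- exists x, 0; split => //; first exact: cone0.
    by rewrite subr0.
  by rewrite fx linear0 addr0.
- exists 0, v; split => //; first exact: cone0.
    by rewrite sub0r.
  by rewrite fv linear0 add0r.
move=> x y l; rewrite !inE.
move=> -[p [q [Xpp Xpq xpq pq]]] [p' [q' [Xpp' Xpq' ypq pq']]].
have l0 : 0 <= l%:num by [].
have l1 : 0 <= 1 - l%:num by rewrite subr_ge0.
exists (l%:num *: p + (1 - l%:num) *: p').
exists (l%:num *: q + (1 - l%:num) *: q').
split.
- by apply: (coneD cX); apply: (coneZ cX).
- by apply: (coneD cX); apply: (coneZ cX).
- by rewrite /conv/= xpq ypq !scalerBr opprD addrACA.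
- by rewrite !linearD !linearZ/=; nra.
Qed.

(** A decomposition of [u] of value at most [1] scales to one of [l *: u] of
value at most [l], and the norm of [x] is the infimum of the [l] with
[x = l *: u] for some [u] in the convex hull. *)
Lemma base_norm_decomp x e : 0 < e ->
  exists p q, [/\ Xp p, Xp q, x = p - q & f p + f q < `|x| + e].
Proof.
move=> e0; have [->|x0] := eqVneq x 0.
  exists 0, 0; split; rewrite ?subr0//; try exact: cone0.
  by rewrite linear0 normr0 !add0r.
have := obsb_norm HX x; rewrite /gauge; set E := [set _ | _] => nE.
(* The infimum of the empty set is 0, so [E] empty would force [x = 0]. *)
have [E0|/set0P En] := eqVneq E set0.
  by move: nE x0; rewrite E0 inf0 => /eqP; rewrite normr_eq0 => ->.
have /inf_adherent : has_inf E by split=> //; exists 0 => l [].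
move=> /(_ _ e0)[l [l0 [u Uu lux]]]; rewrite -nE => le.
have [p [q [Xpp Xpq upq pq]]] := base_ball_decomp Uu.
exists (l *: p), (l *: q); split.
- exact: coneZ.
- exact: coneZ.
- by rewrite -lux upq scalerBr.
- by apply: le_lt_trans _ le; rewrite !linearZ/= -mulrDr ler_piMr.
Qed.

Lemma norm_base_le1 u : base Xp f u -> `|u| <= 1.
Proof.
move=> Ku; rewrite (obsb_norm HX); apply: ge_inf; first by exists 0 => l [].
split=> //; exists u; last by rewrite scale1r.
by apply: sub_gen_smallest; left.
Qed.

Lemma cone_base x : Xp x -> x != 0 -> base Xp f ((f x)^-1 *: x).
Proof.
move=> Xx x0; have fx := obsb_strictly_positive HX Xx x0.
by split; [apply: (coneZ cX); rewrite // invr_ge0 ltW|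
  rewrite linearZ/= mulVf// gt_eqF].
Qed.

Lemma norm_cone_le x : Xp x -> `|x| <= f x.
Proof.
move=> Xx; have [->|x0] := eqVneq x 0; first by rewrite normr0 linear0.
have fx := obsb_strictly_positive HX Xx x0.
have := norm_base_le1 (cone_base Xx x0).
by rewrite normrZ gtr0_norm ?invr_gt0// mulrC ler_pdivrMr// mul1r.
Qed.

Lemma base_nonempty : base Xp f !=set0.
Proof.
have [x x0] := obsb_nontrivial HX.
have [p [q [Xpp Xpq xpq]]] := obsb_generating HX x.
have [p0|p0] := eqVneq p 0; last by exists ((f p)^-1 *: p); exact: cone_base.
have [q0|q0] := eqVneq q 0; last by exists ((f q)^-1 *: q); exact: cone_base.
by move: x0; rewrite xpq p0 q0 subr0 eqxx.
Qed.

(** When [f x = 0], the two cone parts of [x] have the same value under [f], so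
they are points of the base scaled by a common factor. *)
Lemma kernel_decomp x e : 0 < e -> f x = 0 ->
  exists r u v, [/\ 0 <= r, base Xp f u, base Xp f v, x = r *: (u - v) &
    r * 2 < `|x| + e].
Proof.
move=> e0 fx; have [p [q [Xpp Xpq xpq pq]]] := base_norm_decomp x e0.
have fpq : f p = f q by apply/eqP; rewrite -subr_eq0 -linearB -xpq fx.
have fne0 y : Xp y -> y != 0 -> f y != 0.
  by move=> Xy y0; rewrite gt_eqF// (obsb_strictly_positive HX).
have [p0|p0] := eqVneq p 0.
  have q0 : q = 0.
    apply: contraPeq fpq => /(fne0 _ Xpq) fq.
    by rewrite p0 linear0; apply/eqP; rewrite eq_sym.
  have [w Kw] := base_nonempty.
  exists 0, w, w; split; rewrite // ?xpq ?p0 ?q0 ?subrr ?scaler0//.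
  by rewrite mul0r normr0 add0r.
have q0 : q != 0.
  by apply: contraNneq (fne0 _ Xpp p0) => q0; rewrite fpq q0 linear0.
exists (f p), ((f p)^-1 *: p), ((f q)^-1 *: q); split.
- exact: functional_ge0.
- exact: cone_base.
- exact: cone_base.
- by rewrite -fpq -scalerBr scalerA mulfV ?fne0// scale1r.
- by rewrite mulr2n mulrDr mulr1 {2}fpq.
Qed.

(** * Markov operators *)

Section markov.
Context (T : {linear X -> X}) (HT : markov_operator Xp f T).

Lemma markov_base u : base Xp f u -> base Xp f (T u).
Proof. by move=> Ku; apply: HT.2; exists u. Qed.

(** [f] is constantly [1] on the base, which [T] preserves; by scaling and
differences this determines [f] on the image of the whole space. *)
Lemma markov_functional x : f (T x) = f x.
Proof.
have fT p : Xp p -> f (T p) = f p.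
  move=> Xpp; have [->|p0] := eqVneq p 0; first by rewrite !linear0.
  have fp := obsb_strictly_positive HX Xpp p0.
  have [_] := markov_base (cone_base Xpp p0).
  rewrite !linearZ/= => /(canRL (mulKf _)) -> //.
    by rewrite invrK mulr1.
  by rewrite invr_eq0 gt_eqF.
have [p [q [Xpp Xpq ->]]] := obsb_generating HX x.
by rewrite !linearB/= !fT.
Qed.

Lemma markov_contraction x : `|T x| <= 1 * `|x|.
Proof.
rewrite mul1r; apply/ler_addgt0Pr => e e0.
have [p [q [Xpp Xpq xpq pq]]] := base_norm_decomp x e0.
apply: le_trans _ (ltW pq); rewrite xpq linearB/=.
apply: le_trans (ler_normB _ _) _.
rewrite -(markov_functional p) -(markov_functional q).
by apply: lerD; apply: norm_cone_le; apply: HT.1.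
Qed.

Lemma markov_dobrushin x : f x = 0 -> `|T x| <= dobrushin f T * `|x|.
Proof. by apply: le_dobrushin (@ler01 R) markov_contraction. Qed.

Lemma markov_base_diam_le u v : base Xp f u -> base Xp f v ->
  `|T u - T v| <= 2 * dobrushin f T.
Proof.
move=> Ku Kv; rewrite -linearB/=.
have fuv : f (u - v) = 0 by rewrite linearB/= Ku.2 Kv.2 subrr.
apply: le_trans (markov_dobrushin fuv) _.
rewrite mulrC ler_wpM2r ?dobrushin_ge0//.
by apply: le_trans (ler_normB _ _) _; rewrite [2]/(1 + 1) lerD ?norm_base_le1.
Qed.

(** Two points of the base are at distance at most [2] and differ by an element
of the kernel, which bounds the coefficient from below; [kernel_decomp] writes
an element of the kernel as a multiple of such a difference, which bounds it
from above. *)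
Lemma dobrushin_base : dobrushin f T =
  2^-1 * sup [set `|T uv.1 - T uv.2| | uv in base Xp f `*` base Xp f].
Proof.
set E := [set _ | _ in _].
have Eub : ubound E (2 * dobrushin f T).
  by move=> _ [[u v] [Ku Kv] <-]; exact: markov_base_diam_le.
have [w Kw] := base_nonempty.
have E0 : E 0 by exists (w, w) => //=; rewrite subrr normr0.
have Eb : has_ubound E by exists (2 * dobrushin f T).
have supE0 : 0 <= sup E by exact: ub_le_sup.
apply/eqP; rewrite eq_le; apply/andP; split; last first.
  by rewrite mulrC ler_pdivrMr// mulrC; apply: ge_sup => //; exists 0.
apply: dobrushin_le => [|x fx]; first by rewrite mulr_ge0 ?invr_ge0.
set c := 2^-1 * sup E; have c0 : 0 <= c by rewrite mulr_ge0 ?invr_ge0.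
apply/ler_addgt0Pr => e e0.
(* This tolerance is chosen so that, once multiplied by [c], it is at most [e];
   the denominator is [c + 1] because [c] may be 0. *)
have e'0 : 0 < e / (c + 1) by rewrite divr_gt0// ltr_wpDl.
have [r [u [v [r0 Ku Kv xE ruv]]]] := kernel_decomp e'0 fx.
have TuvE : `|T u - T v| <= sup E by apply: ub_le_sup => //; exists (u, v).
have -> : T x = r *: (T u - T v) by rewrite xE linearZ/= linearB.
rewrite normrZ ger0_norm//.
apply: (@le_trans _ _ (c * (`|x| + e / (c + 1)))).
  apply: le_trans (ler_wpM2l r0 TuvE) _.
  by rewrite /c mulrAC ler_wpM2r// mulrC ler_pdivlMr// ltW.
rewrite mulrDr lerD2l mulrCA ler_piMr ?(ltW e0)//.
by rewrite ler_pdivrMr ?mul1r ?lerDl// ltr_wpDl.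
Qed.

(** With [w] in the base, [x - f x *: w] lies in the kernel of [f], where [T]
vanishes; so [T w] is the required vector. *)
Lemma dobrushin_eq0_rank_one : dobrushin f T = 0 ->
  exists y, Xp y /\ forall x, T x = rank_one f y x.
Proof.
move=> d0; have [w Kw] := base_nonempty.
exists (T w); split; first exact: (markov_base Kw).1.
move=> x; have /markov_dobrushin: f (x - f x *: w) = 0.
  by rewrite linearB linearZ/= Kw.2 mulr1 subrr.
by rewrite d0 mul0r normr_le0 linearB linearZ/= subr_eq0 => /eqP ->.
Qed.

End markov.
End base_norm.

Theorem theorem3p3 (R : realType) (X : completeNormedModType R) (Xp : set X)
    (f : {scalar X}) (HX : obsb Xp f) (T S : {linear X -> X})
    (HT : markov_operator Xp f T) (HS : markov_operator Xp f S) :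
  (0 <= dobrushin f T <= 1) /\
  (`|dobrushin f T - dobrushin f S| <= dobrushin f (T \- S) /\
      dobrushin f (T \- S) <= opnorm (T \- S)) /\
  dobrushin f (T \o S) <= dobrushin f T * dobrushin f S /\
  (forall H : {linear X -> X}, bounded_near H (nbhs (0 : X)) ->
      (forall x : X, f (H x) = 0) ->
      opnorm (T \o H) <= dobrushin f T * opnorm H) /\
  dobrushin f T = 2^-1 * sup [set `|T uv.1 - T uv.2| |
      uv in base Xp f `*` base Xp f] /\
  (dobrushin f T = 0 ->
      exists y0 : X, Xp y0 /\ (forall x : X, T x = rank_one f y0 x)).
Proof.
have T1 := markov_contraction HX HT; have S1 := markov_contraction HX HS.
have dM0 : 0 <= dobrushin f T * dobrushin f S.
  by rewrite mulr_ge0 ?dobrushin_ge0.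
split.
  by rewrite dobrushin_ge0; apply: dobrushin_le => // x _; exact: T1.
split.
  split.
    have TS := dobrushin_leD f (@ler01 R) (@ler01 R) T1 S1.
    have ST := dobrushin_leD f (@ler01 R) (@ler01 R) S1 T1.
    by rewrite ler_norml lerNl opprB !lerBlDr TS dobrushin_subC ST.
  apply: (@dobrushin_le_opnorm _ _ _ (T \- S) (1 + 1)) => // x.
  by rewrite mulrDl; apply: le_trans (ler_normB _ _) _; exact: lerD.
split.
  apply: (@dobrushin_le _ _ f (T \o S)) => // x fx /=.
  have fSx : f (S x) = 0 by rewrite (markov_functional HX HS).
  apply: le_trans (markov_dobrushin HX HT fSx) _.
  by rewrite -mulrA ler_wpM2l ?dobrushin_ge0// (markov_dobrushin HX HS).
split.
  move=> H /linear_boundedP bH fH.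
  have [c [c0 Hc]] : exists c : R, 0 <= c /\ forall x, `|H x| <= c * `|x|.
    near (+oo : set_system R) => c; exists c; split; near: c.
      exact: nbhs_pinfty_ge.
    exact: bH.
  apply: (@opnorm_le _ _ (T \o H)) => [|x /=].
    by rewrite mulr_ge0 ?dobrushin_ge0 ?opnorm_ge0.
  apply: le_trans (markov_dobrushin HX HT (fH x)) _.
  by rewrite -mulrA ler_wpM2l ?dobrushin_ge0// (le_opnorm _ c0 Hc).
split; first exact: (dobrushin_base HX HT).
exact: (dobrushin_eq0_rank_one HX HT).
Unshelve. all: end_near.
Qed.
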